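(* Assume $n\ge5$. Let $\vartheta_1,\dots,\vartheta_n$ be real numbers that satisfy the positivity constraints and satisfy the holonomy constraints strictly. Then there is a choice of distinct $i,j\in\{1,\dots,n\}$ such that at least one of the following two $(n-1)$-tuples $$(\vartheta_1,\dots,\widehat{\vartheta_i},\dots,\widehat{\vartheta_j},\dots,\vartheta_n,\ \vartheta_i+\vartheta_j-1),\qquad (\vartheta_1,\dots,\widehat{\vartheta_i},\dots,\widehat{\vartheta_j},\dots,\vartheta_n,\ \vartheta_i-\vartheta_j-1)$$ (obtained by removing the $i$-th and $j$-th entries and appending the indicated last entry) satisfies the positivity constraints and, strictly, the holonomy constraints.
   Context: For any $k\geq 1$ and $\vartheta=(\vartheta_1,\dots,\vartheta_k)\in\mathbb R^k$: $\vartheta$ satisfies the positivity constraints if $\vartheta_i>0$ for all $i$ and $\sum_{i=1}^k(\vartheta_i-1)>-2$; it satisfies the holonomy constraints strictly if $d_1(\vartheta-\mathbf 1,\mathbb Z^k_o)>1$. Here $\mathbf 1=(1,\dots,1)\in\mathbb R^k$, $d_1$ is the standard $\ell^1$ distance on $\mathbb R^k$, and $\mathbb Z^k_o$ is the set of $m\in\mathbb Z^k$ with $\|m\|_1$ odd. *)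

(* Defs.v *)
From mathcomp Require Import all_boot all_order all_algebra.
From mathcomp Require Import all_classical all_reals.

Set Implicit Arguments.
Unset Strict Implicit.
Unset Printing Implicit Defensive.
Import Order.TTheory GRing.Theory Num.Theory.
Local Open Scope ring_scope.
Local Open Scope classical_set_scope.

Definition l1norm (R : numDomainType) (k : nat) (x : 'rV[R]_k) : R :=
  \sum_i `|x 0 i|.

(* For nonempty [A] the infimum is that of a nonempty set bounded below by 0,
   so [inf] has its usual meaning; [inf] of the empty set would be 0. *)
Definition d1 (R : realType) (k : nat) (x : 'rV[R]_k) (A : set 'rV[R]_k) : R :=
  inf [set l1norm (x - y) | y in A].

(* [`|_|%N] only casts the nonnegative integer [l1norm m] to [nat]. *)
Definition Zodd (R : realType) (k : nat) : set 'rV[R]_k :=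
  [set map_mx intr m | m in [set m : 'rV[int]_k | odd `|l1norm m|%N]].

Definition positivity (R : realType) (k : nat) (theta : 'rV[R]_k) : Prop :=
  (forall i, 0 < theta 0 i) /\ - 2 < \sum_i (theta 0 i - 1).

Definition strict_holonomy (R : realType) (k : nat) (theta : 'rV[R]_k) : Prop :=
  1 < d1 (theta - const_mx 1) (@Zodd R k).

(* For [i != j] the sequence below has exactly [n.-1] entries, so the default
   value of the indexing [_`_l] is never used. *)
Definition merge_pair (R : realType) (n : nat) (theta : 'rV[R]_n) (i j : 'I_n)
    (a : R) : 'rV[R]_n.-1 :=
  \row_l (rcons [seq theta 0 k | k <- enum 'I_n & (k != i) && (k != j)] a)`_l.

(* Main.v *)
Require Import Defs.
From mathcomp Require Import all_boot all_order all_algebra.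
From mathcomp Require Import all_classical all_reals.
From mathcomp Require Import zify ring lra.
Import Order.TTheory GRing.Theory Num.Theory.
Local Open Scope ring_scope.

(** Write [x k = theta k - 1] and [S = \sum_k x k].  Positivity says that every
[x k > -1] and [S > -2]; strict holonomy says that every integer point with
odd coordinate sum is at l1-distance more than 1 from [x].  The sum merge
replaces [x i] and [x j] by [x i + x j]; it keeps positivity as soon as
[x i + x j > -1].  The difference merge replaces them by [x i - x j - 2]; it
keeps positivity when [x i > x j + 1] and [S > 2 * x j].  What has to be
controlled is holonomy.

Holonomy after a sum merge fails only through an odd point [m'] (a witness).
Since the unmerged tuple satisfies holonomy, merging must have brought [x]
closer to [m'], so [x i] and [x j] lie on opposite sides of the coordinates
of [m'], however the sum [m' i + m' j] is split in two.  Hence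
[m' i + m' j] is the sum of the two integer parts plus one, and neither [x i]
nor [x j] is an integer; in particular an integral entry can be merged with
any other.

Let [m] be a closest point to [x] with even coordinate sum and
[b k = `|x k - m k|].  Comparing a witness with [m], and using the minimality
of [m] on the coordinates away from [i] and [j], turns failure into an
inequality on [b]: if [x - m] has the same sign at [i] and [j], failure gives
[\sum_(k != i, j) b k <= b i + b j] ([fold_fail_same]); if the signs are
opposite, failure gives an index [l] such that [b l] is at least
[`|b i - b j|] plus all remaining [b k] ([fold_fail_opp]).  The difference
merge behaves like the sum merge with the sign at [j] reversed.  Two
consequences need at least five entries, so that some positive [b k] is
always left over.  Some sum merge keeps holonomy: merge the two smallest [b]
when their signs agree, and otherwise the largest with one of these two
([exists_foldable]).  If both merges of [i] and [j] fail, then the sum merge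
of [i] with a suitable third entry succeeds ([fold_fail_next]).

Positivity is reconciled with this by cases on the position of the entries;
let [q] be the index of the smallest one.

- Some [x p > x q + 1] and [S > 2 * x q]: both merges of [p] and [q] keep
  positivity, and [x p > 0] makes every sum merge with [p] harmless, so
  [fold_fail_next] concludes.
- Some [x p > x q + 1] and [S <= 2 * x q]: then [-2 < S < 0] forces a witness
  to have coordinate sum [-1], and this is so rigid that failure for [p, q]
  determines the tuple well enough to merge [p] with a third entry
  ([fold_fail_low_sum], [reducible_low_sum]).
- All entries lie in a window of length 1.  If all pairwise sums exceed [-1],
  [exists_foldable] concludes.  Otherwise either all entries are negative, and
  the two largest can be merged ([reducible_negative]), or the largest entry
  [p] is positive and can be merged with the smallest one or with a third
  entry ([window_fail], [window_next]). *)

Set Implicit Arguments.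
Unset Strict Implicit.

(** * Parity of integers *)

Definition oddz (z : int) : bool := odd `|z|%N.

Lemma oddzD a b : oddz (a + b) = oddz a (+) oddz b.
Proof. rewrite /oddz; lia. Qed.

Lemma oddzN a : oddz (- a) = oddz a.
Proof. by rewrite /oddz abszN. Qed.

Lemma oddz_bool (c : bool) : oddz c%:Z = c.
Proof. by case: c. Qed.

Lemma oddz_sum (I : Type) (r : seq I) (P : pred I) (F : I -> int) :
  oddz (\sum_(k <- r | P k) F k) = \big[addb/false]_(k <- r | P k) oddz (F k).
Proof. by apply: big_morph => // a b; rewrite oddzD. Qed.

Lemma oddz_sum_congr (I : Type) (r : seq I) (P : pred I) (F G : I -> int) :
  (forall k, P k -> oddz (F k) = oddz (G k)) ->
  oddz (\sum_(k <- r | P k) F k) = oddz (\sum_(k <- r | P k) G k).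
Proof. by move=> FG; rewrite !oddz_sum; apply: eq_bigr. Qed.

Lemma exists_odd_term (I : finType) (P : pred I) (F : I -> int) :
  oddz (\sum_(k | P k) F k) -> exists2 k, P k & oddz (F k).
Proof.
have [k /andP[Pk Fk] _|none] := pickP (fun k => P k && oddz (F k)).
  by exists k.
by rewrite oddz_sum big1 // => k Pk; have := none k; rewrite Pk.
Qed.

(** * Sums over the complement of a list of indices *)

Lemma sum_off (V : zmodType) (n : nat) (s : seq 'I_n) (F : 'I_n -> V) :
  uniq s -> \sum_k F k = \sum_(k <- s) F k + \sum_(k | k \notin s) F k.
Proof. by move=> us; rewrite (bigID (mem s)) /= -big_uniq. Qed.

Lemma sum_off_cons (V : zmodType) (n : nat) (s : seq 'I_n) l (F : 'I_n -> V) :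
  l \notin s ->
  \sum_(k | k \notin s) F k = F l + \sum_(k | k \notin l :: s) F k.
Proof.
move=> ls; rewrite (bigD1 l) //=; congr (_ + _); apply: eq_bigl => k.
by rewrite inE negb_or andbC.
Qed.

Lemma exists_off (n : nat) (s : seq 'I_n) :
  (size s < n)%N -> exists k, k \notin s.
Proof.
move=> sn; have [k ks|sT] := pickP (fun k => k \notin s); first by exists k.
have: (#|'I_n| <= size s)%N.
  rewrite (leq_trans _ (card_size s)) // subset_leq_card //.
  by apply/fintype.subsetP => k _; have /negbFE := sT k.
by rewrite card_ord leqNgt sn.
Qed.

Lemma sum_off_ge0 (R : realDomainType) (n : nat) (s : seq 'I_n)
    (F : 'I_n -> R) :
  (forall k, k \notin s -> 0 <= F k) -> 0 <= \sum_(k | k \notin s) F k.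
Proof. by move=> F0; apply: sumr_ge0. Qed.

Lemma sum_off_gt0 (R : realDomainType) (n : nat) (s : seq 'I_n)
    (F : 'I_n -> R) :
  (size s < n)%N -> (forall k, k \notin s -> 0 < F k) ->
  0 < \sum_(k | k \notin s) F k.
Proof.
move=> /exists_off[l ls] F0; rewrite (sum_off_cons F ls).
apply: ltr_pwDl; first exact: F0.
apply: sum_off_ge0 => k; rewrite inE negb_or => /andP[_ ks].
exact/ltW/F0.
Qed.

Lemma eq_sum_off (V : zmodType) n (s s' : seq 'I_n) (F : 'I_n -> V) :
  s =i s' -> \sum_(k | k \notin s) F k = \sum_(k | k \notin s') F k.
Proof. by move=> ss'; apply: eq_bigl => k; rewrite ss'. Qed.

Lemma sum_off_ge1 (R : realDomainType) n (s : seq 'I_n) (F : 'I_n -> R) a :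
  (forall k, k \notin s -> 0 <= F k) -> a \notin s ->
  F a <= \sum_(k | k \notin s) F k.
Proof.
move=> F0 as_; rewrite (sum_off_cons F as_) lerDl; apply: sum_off_ge0 => k.
by rewrite inE negb_or => /andP[_]; apply: F0.
Qed.

Lemma sum_off_ge2 (R : realDomainType) n (s : seq 'I_n) (F : 'I_n -> R) a c :
  (forall k, k \notin s -> 0 <= F k) -> a \notin s -> c \notin a :: s ->
  F a + F c <= \sum_(k | k \notin s) F k.
Proof.
move=> F0 as_ cas; rewrite (sum_off_cons F as_) lerD2l; apply: sum_off_ge1 => // k.
by rewrite inE negb_or => /andP[_]; apply: F0.
Qed.

(** * Distances to integer points of given parity *)

Definition far_from_odd (R : realType) n (x : 'I_n -> R) : Prop :=
  forall m : 'I_n -> int,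
  oddz (\sum_k m k) -> 1 < \sum_k `|x k - (m k)%:~R|.

Definition closest (R : realType) n (c : bool) (x : 'I_n -> R)
    (m : 'I_n -> int) : Prop :=
  oddz (\sum_k m k) = c /\
  forall m' : 'I_n -> int, oddz (\sum_k m' k) = c ->
    \sum_k `|x k - (m k)%:~R| <= \sum_k `|x k - (m' k)%:~R|.

(** Strict holonomy of the shorter tuple in which the entries [i] and [j] are
    replaced by [a], phrased without renumbering: only the sum [m i + m j]
    matters, and it plays the role of the coordinate of the new entry. *)
Definition foldable (R : realType) n (x : 'I_n -> R) (i j : 'I_n) (a : R) :=
  forall m : 'I_n -> int, oddz (\sum_k m k) ->
  1 < `|a - (m i + m j)%:~R| + \sum_(k | k \notin [:: i; j]) `|x k - (m k)%:~R|.

Lemma floor_bounds (R : realType) (y : R) :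
  (Num.floor y)%:~R <= y < (Num.floor y)%:~R + 1.
Proof. by have := floor_itv y; rewrite intrD. Qed.

Lemma floor_neg (R : realType) (y : R) : -1 <= y -> y < 0 -> Num.floor y = -1.
Proof. by move=> y_ge y_lt; apply: floor_def; rewrite addNr y_ge. Qed.

Lemma floor_pos (R : realType) (y : R) : 0 <= y -> y < 1 -> Num.floor y = 0.
Proof. by move=> y_ge y_lt; apply: floor_def; rewrite add0r y_ge. Qed.

(** Of the two integers that bracket [y], the one with the parity of [z]. *)
Definition clamp (R : realType) (y : R) (z : int) : int :=
  Num.floor y + (oddz (z - Num.floor y))%:Z.

Lemma oddz_clamp (R : realType) (y : R) z : oddz (clamp y z) = oddz z.
Proof. by rewrite /clamp oddzD oddz_bool oddzD oddzN addbCA addbb addbF. Qed.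

(** An integer outside the bracket and the bracketing integer of the same
    parity differ by at least 2, while the latter is within 1 of [y]. *)
Lemma clamp_le (R : realType) (y : R) z :
  `|y - (clamp y z)%:~R| <= `|y - z%:~R|.
Proof.
have /andP[lo hi] := floor_bounds y.
rewrite /clamp; set f := Num.floor y in lo hi *.
have [d zE] : exists d, z = f + d by exists (z - f); lia.
rewrite zE addrAC subrr add0r !intrD.
have [->|d0] := eqVneq d 0; first by rewrite /oddz.
have [->|d1] := eqVneq d 1; first by rewrite /oddz.
have [d2|d2] : (2 <= d) \/ (d <= -1) by lia.
  have : (2 : R) <= d%:~R by rewrite (ler_int R 2).
  case: (oddz d) => /= d2'; rewrite ?mulr0z ?mulr1z;
    rewrite ?[`|y - (_ + d%:~R)|]ler0_norm; try lra.
    by rewrite ler0_norm; lra.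
  by rewrite ger0_norm; lra.
have : d%:~R <= (-1 : R) by rewrite (ler_int R _ (-1)).
case: (oddz d) => /= d2'; rewrite ?mulr0z ?mulr1z;
  rewrite ?[`|y - (_ + d%:~R)|]ger0_norm; try lra.
  by rewrite ler0_norm; lra.
by rewrite ger0_norm; lra.
Qed.

(** By [clamp_le] only the corners of the unit cube containing [x] compete,
    and these are finitely many. *)
Lemma exists_closest (R : realType) n (c : bool) (x : 'I_n -> R) :
  (0 < n)%N -> exists m, closest c x m.
Proof.
move=> n0; pose pt (e : {ffun 'I_n -> bool}) k := Num.floor (x k) + (e k)%:Z.
pose P e := oddz (\sum_k pt e k) == c.
pose i0 := Ordinal n0.
(* One coordinate is raised if the integer parts have the wrong parity. *)
pose s0 := oddz (\sum_k Num.floor (x k)) (+) c.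
pose e0 := [ffun k => (k == i0) && s0].
have e0E : \sum_k (e0 k)%:Z = s0%:Z.
  rewrite (bigD1 i0) //= big1 => [|k ki]; last by rewrite ffunE (negbTE ki).
  by rewrite addr0 ffunE eqxx.
have P0 : P e0 by rewrite /P big_split /= e0E oddzD oddz_bool /s0 addKb.
pose F e := \sum_k `|x k - (pt e k)%:~R|.
have [e /eqP Pe eP] := arg_minP F P0.
exists (pt e); split=> // m' m'c.
pose e' := [ffun k => oddz (m' k - Num.floor (x k))].
have e'E k : pt e' k = clamp (x k) (m' k) by rewrite /pt ffunE.
apply: le_trans (eP e' _) _.
  apply/eqP; rewrite -m'c; apply: oddz_sum_congr => k _.
  by rewrite e'E oddz_clamp.
by apply: ler_sum => k _; rewrite e'E clamp_le.
Qed.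

(** Minimality localizes: away from the indices in [s], any modification of [m]
    that preserves the parity of the total can be grafted onto [m]. *)
Lemma closest_off (R : realType) n c (x : 'I_n -> R) m (s : seq 'I_n) m' :
  closest c x m -> ~~ oddz (\sum_(k | k \notin s) (m' k - m k)) ->
  \sum_(k | k \notin s) `|x k - (m k)%:~R| <=
    \sum_(k | k \notin s) `|x k - (m' k)%:~R|.
Proof.
move=> [mc m_min] par; pose m2 k := if k \in s then m k else m' k.
have m2B : \sum_k m2 k = \sum_k m k + \sum_(k | k \notin s) (m' k - m k).
  rewrite (bigID (mem s)) [in RHS](bigID (mem s)) /= -addrA -big_split /=.
  congr (_ + _); apply: eq_bigr => k ks; first by rewrite /m2 ks.
  by rewrite /m2 (negbTE ks) addrC subrK.
have m2c : oddz (\sum_k m2 k) = c by rewrite m2B oddzD mc (negbTE par) addbF.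
have := m_min m2 m2c.
rewrite (bigID (mem s)) /= [leRHS](bigID (mem s)) /=.
rewrite (eq_bigr (fun k => `|x k - (m2 k)%:~R|)) => [|k ks]; last first.
  by rewrite /m2 ks.
rewrite lerD2l => /le_trans; apply.
by under eq_bigr => k ks do rewrite /m2 (negbTE ks).
Qed.

(** Moving one coordinate of [m] by 2 preserves parity, and would be an
    improvement if that coordinate were further than 1 from [x]. *)
Lemma closest_le1 (R : realType) n c (x : 'I_n -> R) m k :
  closest c x m -> `|x k - (m k)%:~R| <= 1.
Proof.
move=> [mc m_min]; pose m2 t k' := if k' == k then m k + t else m k'.
have step (t : int) : ~~ oddz t ->
    `|x k - (m k)%:~R| <= `|x k - (m k)%:~R - t%:~R|.
  move=> te; have m2c : oddz (\sum_k m2 t k) = c.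
    rewrite -mc (bigD1 k) //= [in RHS](bigD1 k) //= /m2 eqxx.
    under eq_bigr => i /negbTE ik do rewrite ik.
    by rewrite !oddzD (negbTE te) addbF.
  have := m_min _ m2c; rewrite (bigD1 k) //= [leRHS](bigD1 k) //= /m2 eqxx.
  under [in leRHS]eq_bigr => i /negbTE ik do rewrite ik.
  by rewrite lerD2r intrD opprD addrA.
have := step 2 isT; have := step (-2) isT.
rewrite (_ : (-2)%:~R = - 2 :> R)// (_ : 2%:~R = 2 :> R)//.
set u := x k - _; case: (ger0P u) => u0.
- by move=> _; case: (ger0P (u - 2)) => ? ?; lra.
- by case: (ger0P (u - - 2)) => ? ? ?; lra.
Qed.

(** * Failure of a sum merge *)

Definition witness (R : realType) n (x : 'I_n -> R) (i j : 'I_n) (a : R) m :=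
  oddz (\sum_k m k) /\
  `|a - (m i + m j)%:~R| + \sum_(k | k \notin [:: i; j]) `|x k - (m k)%:~R| <= 1.

Lemma nfoldableP (R : realType) n (x : 'I_n -> R) i j a :
  ~ foldable x i j a -> exists m, witness x i j a m.
Proof.
move=> nf; apply: contrapT => nw; apply: nf => m mo.
by rewrite ltNge; apply/negP => wm; apply: nw; exists m.
Qed.

(** If the two factors had the same sign, the triangle inequality for their
    sum would be an equality, and the witness would already violate holonomy
    before the merge. *)
Lemma witness_split (R : realType) n (x : 'I_n -> R) i j m p q :
  i != j -> far_from_odd x -> witness x i j (x i + x j) m -> p + q = m i + m j ->
  (x i - p%:~R) * (x j - q%:~R) < 0.
Proof.
move=> ij x_hol [mo mw] pq; rewrite ltNge; apply/negP => sgn.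
have us : uniq [:: i; j] by rewrite /= inE ij.
pose m2 k := if k == i then p else if k == j then q else m k.
have m2i : m2 i = p by rewrite /m2 eqxx.
have m2j : m2 j = q by rewrite /m2 eqxx eq_sym (negbTE ij).
have m2k k : k \notin [:: i; j] -> m2 k = m k.
  by rewrite !inE negb_or /m2 => /andP[/negbTE-> /negbTE->].
have m2o : oddz (\sum_k m2 k).
  move: mo; rewrite !(sum_off _ us) !big_cons !big_nil !addr0 m2i m2j pq.
  by under [in X in _ -> X]eq_bigr => k /m2k-> do [].
have := x_hol _ m2o; rewrite (sum_off _ us) !big_cons big_nil addr0 m2i m2j.
under eq_bigr => k /m2k-> do [].
apply/negP; rewrite -leNgt (le_trans _ mw) // lerD2r -pq intrD.
rewrite [x i + x j - _](_ : _ = (x i - p%:~R) + (x j - q%:~R)); last by ring.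
move: sgn; set u := x i - _; set v := x j - _ => uv.
case: (ger0P u) => u0; case: (ger0P v) => v0.
- by rewrite ger0_norm; lra.
- have -> : u = 0 by nra.
  by rewrite !add0r ltr0_norm.
- have -> : v = 0 by nra.
  by rewrite !addr0 ltr0_norm.
- by rewrite ler0_norm; lra.
Qed.

(** Apply [witness_split] with [p] one of the two integers that bracket [x i]:
    the sign changes leave a single value for [m i + m j]. *)
Lemma witness_floor (R : realType) n (x : 'I_n -> R) i j m :
  i != j -> far_from_odd x -> witness x i j (x i + x j) m ->
  [/\ m i + m j = Num.floor (x i) + Num.floor (x j) + 1,
      (Num.floor (x i))%:~R < x i & (Num.floor (x j))%:~R < x j].
Proof.
move=> ij x_hol mw.
have sp p := @witness_split _ _ _ _ _ _ p (m i + m j - p) ij x_hol mw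
  (subrKC _ _).
have := sp (Num.floor (x i)); have := sp (Num.floor (x i) + 1).
have /andP[loi hii] := floor_bounds (x i).
have /andP[loj hij] := floor_bounds (x j).
set f := Num.floor (x i) in loi hii *; set g := Num.floor (x j) in loj hij *.
have [d dE] : exists d, m i + m j = f + g + d by exists (m i + m j - f - g); lia.
rewrite dE; rewrite !(intrD, intrN) => s1 s0.
have fi : f%:~R < x i by nra.
have d0 : 0 < d by rewrite -(ltr_int R); nra.
have d2 : d < 2 by rewrite -(ltr_int R); nra.
have d1 : d = 1 by lia.
by rewrite d1 in s1 s0 *; split => //; nra.
Qed.

Lemma mulr_ge0_cases (R : realDomainType) (a b : R) :
  0 <= a * b -> (0 <= a /\ 0 <= b) \/ (a <= 0 /\ b <= 0).
Proof.
move=> ab; case: (ltgtP a 0) => a0; case: (ltgtP b 0) => b0;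
  first [by left; split; lra | by right; split; lra | nra].
Qed.

Lemma oddz_off (n : nat) (s : seq 'I_n) (m m' : 'I_n -> int) :
  uniq s -> oddz (\sum_k m k) = false -> oddz (\sum_k m' k) ->
  oddz (\sum_(k | k \notin s) (m' k - m k)) =
    ~~ oddz (\sum_(k <- s) m' k - \sum_(k <- s) m k).
Proof.
move=> us; rewrite !(sum_off _ us) sumrB !(oddzD, oddzN).
set a := oddz _; set b := oddz _; set c := oddz _; set d := oddz _.
by case: a; case: b; case: c; case: d.
Qed.

Lemma int_between0 (R : realDomainType) (d : int) :
  -1 < d%:~R :> R -> d%:~R < 1 :> R -> d = 0.
Proof.
move=> d_gt d_lt; have dl : -1 < d by rewrite -(ltr_int R).
have dr : d < 1 by rewrite -(ltr_int R).
by clear d_gt d_lt; lia.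
Qed.

(** Here [u = x i - m i] and [v = x j - m j] for an even point [m], and [d] is
    the excess of a witness over [m] on the pair; the last hypothesis is the
    sign condition of [witness_split].  Equal signs force [d] to be 1 or -1. *)
Lemma split_same (R : realType) (u v : R) (d : int) :
  `|u| <= 1 -> `|v| <= 1 -> 0 <= u * v ->
  (forall e : int, (u - e%:~R) * (v - d%:~R + e%:~R) < 0) ->
  oddz d /\ 1 - `|u| - `|v| <= `|u + v - d%:~R|.
Proof.
move=> u1 v1 uv sp; have [[s0 s1] s2] := (sp 0, sp 1, sp (-1)); clear sp.
rewrite (_ : (-1)%:~R = -1 :> R) // in s2.
have [[u0 v0]|[u0 v0]] := mulr_ge0_cases uv.
  rewrite ger0_norm // in u1; rewrite ger0_norm // in v1.
  have /eqP : d - 1 = 0.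
    apply: (@int_between0 R); rewrite intrD (_ : (-1)%:~R = -1 :> R) //; nra.
  rewrite subr_eq0 => /eqP->; split=> //; clear s0 s1 s2 uv.
  rewrite mulr1z (ger0_norm u0) (ger0_norm v0) -normrN.
  by apply: le_trans (ler_norm _); lra.
rewrite ler0_norm // in u1; rewrite ler0_norm // in v1.
have /eqP : d + 1 = 0.
  apply: (@int_between0 R); rewrite intrD; nra.
rewrite addr_eq0 => /eqP->; split=> //; clear s0 s1 s2 uv.
rewrite (_ : (-1)%:~R = -1 :> R) // (ler0_norm u0) (ler0_norm v0).
by apply: le_trans (ler_norm _); lra.
Qed.

(** With opposite signs the witness and the even point have the same sum over
    the pair. *)
Lemma split_opp (R : realType) (u v : R) (d : int) :
  `|u| <= 1 -> `|v| <= 1 -> u * v <= 0 ->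
  (forall e : int, (u - e%:~R) * (v - d%:~R + e%:~R) < 0) ->
  d = 0 /\ `| `|u| - `|v| | <= `|u + v|.
Proof.
move=> u1 v1 uv sp; have [s0 s1] := (sp 0, sp d); clear sp.
rewrite mulr0z subr0 addr0 in s0; rewrite subrK in s1.
have uv' : 0 <= u * - v by lra.
have [[u0 v0]|[u0 v0]] := mulr_ge0_cases uv'.
  rewrite ger0_norm // in u1; rewrite ler0_norm in v1; last lra.
  split; first by apply: (@int_between0 R); nra.
  by rewrite (ger0_norm u0) (ler0_norm (_ : v <= 0)) ?opprK //; lra.
rewrite ler0_norm // in u1; rewrite ger0_norm in v1; last lra.
split; first by apply: (@int_between0 R); nra.
rewrite (ler0_norm u0) (ger0_norm (_ : 0 <= v)); last lra.
by rewrite -opprD normrN.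
Qed.

Lemma witness_split_off (R : realType) n (x : 'I_n -> R) (m m' : 'I_n -> int)
    i j d :
  i != j -> far_from_odd x -> witness x i j (x i + x j) m' ->
  m' i + m' j = m i + m j + d ->
  forall e : int,
    (x i - (m i)%:~R - e%:~R) * (x j - (m j)%:~R - d%:~R + e%:~R) < 0.
Proof.
move=> ij x_hol wm' dE e.
rewrite (_ : _ * _ =
  (x i - (m i + e)%:~R) * (x j - (m j + (d - e))%:~R)); last first.
  by rewrite !(intrD, intrN); ring.
by apply: (witness_split ij x_hol wm'); rewrite dE; ring.
Qed.

(** The witness differs from [m] by an odd amount on the pair, hence by an even
    amount elsewhere, where [m] cannot be beaten. *)
Lemma fold_fail_same (R : realType) n (x : 'I_n -> R) m i j :
  i != j -> far_from_odd x -> closest false x m ->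
  0 <= (x i - (m i)%:~R) * (x j - (m j)%:~R) ->
  ~ foldable x i j (x i + x j) ->
  \sum_(k | k \notin [:: i; j]) `|x k - (m k)%:~R|
    <= `|x i - (m i)%:~R| + `|x j - (m j)%:~R|.
Proof.
move=> ij x_hol mP uv /nfoldableP[m' wm']; have [m'o m'1] := wm'.
have us : uniq [:: i; j] by rewrite /= inE ij.
have [d dE] : exists d, m' i + m' j = m i + m j + d.
  by exists (m' i + m' j - (m i + m j)); rewrite subrKC.
have [d_odd fold_le] := split_same (closest_le1 i mP) (closest_le1 j mP) uv
  (witness_split_off ij x_hol wm' dE).
have := closest_off (s := [:: i; j]) (m' := m') mP.
rewrite (oddz_off us _ m'o); last by case: mP.
rewrite !big_cons !big_nil !addr0 dE addrAC subrr add0r d_odd => /(_ isT).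
move: m'1; rewrite dE !intrD.
rewrite [x i + x j - _](_ : _ =
  x i - (m i)%:~R + (x j - (m j)%:~R) - d%:~R); last by ring.
by move: fold_le; lra.
Qed.

(** The witness agrees in sum with [m] on the pair, so it differs from [m] by an
    odd amount elsewhere: some coordinate [l] changes by an odd amount, which
    costs at least [1 - b l], and on the other coordinates the change is even,
    so [m] cannot be beaten there. *)
Lemma fold_fail_opp (R : realType) n (x : 'I_n -> R) m i j :
  i != j -> far_from_odd x -> closest false x m ->
  (x i - (m i)%:~R) * (x j - (m j)%:~R) <= 0 ->
  ~ foldable x i j (x i + x j) ->
  exists2 l, l \notin [:: i; j] &
  `| `|x i - (m i)%:~R| - `|x j - (m j)%:~R| | +
    \sum_(k | k \notin [:: l; i; j]) `|x k - (m k)%:~R| <= `|x l - (m l)%:~R|.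
Proof.
move=> ij x_hol mP uv /nfoldableP[m' wm']; have [m'o m'1] := wm'.
have us : uniq [:: i; j] by rewrite /= inE ij.
have [d dE] : exists d, m' i + m' j = m i + m j + d.
  by exists (m' i + m' j - (m i + m j)); rewrite subrKC.
have [d0 fold_le] := split_opp (closest_le1 i mP) (closest_le1 j mP) uv
  (witness_split_off ij x_hol wm' dE).
have me : oddz (\sum_k m k) = false by case: mP.
have R_odd : oddz (\sum_(k | k \notin [:: i; j]) (m' k - m k)).
  by rewrite (oddz_off us me m'o) !big_cons !big_nil !addr0 dE d0 addr0 subrr.
have [l lR lo] := exists_odd_term R_odd.
exists l => //.
have Rl : ~~ oddz (\sum_(k | k \notin [:: l; i; j]) (m' k - m k)).
  by move: R_odd; rewrite (sum_off_cons _ lR) oddzD lo; case: oddz.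
have off_le := closest_off (s := [:: l; i; j]) mP Rl.
have ml1 : 1 <= `|(m' l)%:~R - (m l)%:~R| :> R.
  rewrite -rmorphB -intr_norm (ler_int _ 1).
  by move: lo; clear; rewrite /oddz; lia.
rewrite (sum_off_cons _ lR) in m'1.
have tri : `|(m' l)%:~R - (m l)%:~R| <=
    `|x l - (m l)%:~R| + `|x l - (m' l)%:~R| :> R.
  by rewrite (distrC (x l) (m' l)%:~R) [leRHS]addrC; apply: ler_distD.
move: m'1; rewrite dE d0 !intrD addr0.
rewrite [x i + x j - _](_ : _ =
  x i - (m i)%:~R + (x j - (m j)%:~R)); last by ring.
by move: fold_le off_le ml1 tri; lra.
Qed.

(** * The difference merge as a reflected sum merge *)

(** Reflecting a coordinate permutes the odd points and the even points, so it
    preserves holonomy and closest points; it exchanges [x i + x j] and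
    [x i - x j]. *)
Definition flip (V : zmodType) n (j : 'I_n) (x : 'I_n -> V) k :=
  if k == j then - x k else x k.

Lemma oddz_flip n j (m : 'I_n -> int) :
  oddz (\sum_k flip j m k) = oddz (\sum_k m k).
Proof.
by apply: oddz_sum_congr => k _; rewrite /flip; case: eqP => // _; rewrite oddzN.
Qed.

Lemma flip_dist (R : realType) n j (x : 'I_n -> R) m k :
  `|flip j x k - (flip j m k)%:~R| = `|x k - (m k)%:~R|.
Proof. by rewrite /flip; case: eqP => // _; rewrite intrN -opprD normrN. Qed.

Lemma flipK (V : zmodType) n (j : 'I_n) (x : 'I_n -> V) k :
  flip j (flip j x) k = x k.
Proof. by rewrite /flip; case: eqP => // _; rewrite opprK. Qed.

Lemma flip_distr (R : realType) n j (x : 'I_n -> R) m k :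
  `|flip j x k - (m k)%:~R| = `|x k - (flip j m k)%:~R|.
Proof. by rewrite -[RHS](flip_dist j) flipK. Qed.

Lemma far_from_odd_flip (R : realType) n j (x : 'I_n -> R) :
  far_from_odd x -> far_from_odd (flip j x).
Proof.
move=> x_hol m mo; under eq_bigr => k _ do rewrite flip_distr.
by apply: x_hol; rewrite oddz_flip.
Qed.

Lemma closest_flip (R : realType) n c j (x : 'I_n -> R) m :
  closest c x m -> closest c (flip j x) (flip j m).
Proof.
move=> [mc m_min]; split=> [|m' m'c]; first by rewrite oddz_flip.
under eq_bigr => k _ do rewrite flip_dist.
under [leRHS]eq_bigr => k _ do rewrite flip_distr.
by apply: m_min; rewrite oddz_flip.
Qed.

(** The shift by [-2] in the difference merge preserves parity. *)
Lemma foldable_minus (R : realType) n (x : 'I_n -> R) i j :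
  i != j -> foldable (flip j x) i j (flip j x i + flip j x j) ->
  foldable x i j (x i - x j - 2).
Proof.
move=> ij fx m mo.
(* The shift by 2 is absorbed by the coordinate at [i]. *)
pose m2 k := m k + (k == i)%:Z * 2.
have m2o : oddz (\sum_k m2 k).
  have -> // : oddz (\sum_k m2 k) = oddz (\sum_k m k).
  apply: oddz_sum_congr => k _.
  by rewrite /m2 oddzD [X in _ (+) X](_ : _ = false) ?addbF //; case: eqP.
have := fx m2 m2o; rewrite /m2 eqxx [j == i]eq_sym (negbTE ij).
rewrite /flip (negbTE ij) eqxx mul0r addr0 mul1r.
rewrite (eq_bigr (fun k => `|x k - (m k)%:~R|)) => [|k]; last first.
  by rewrite !inE negb_or => /andP[/negbTE-> /negbTE->]; rewrite mul0r addr0.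
rewrite (_ : x i - x j - (m i + 2 + m j)%:~R =
  x i - x j - 2 - (m i + m j)%:~R) //.
by rewrite !intrD; ring.
Qed.

(** * Merges that keep holonomy *)

(** One of the two merges sees equal signs at [i] and [j] and the other opposite
    signs, so failure of both gives both inequalities. *)
Lemma fold_fail_both (R : realType) n (x : 'I_n -> R) m i j :
  i != j -> far_from_odd x -> closest false x m ->
  ~ foldable x i j (x i + x j) -> ~ foldable x i j (x i - x j - 2) ->
  \sum_(k | k \notin [:: i; j]) `|x k - (m k)%:~R|
    <= `|x i - (m i)%:~R| + `|x j - (m j)%:~R| /\
  exists2 l, l \notin [:: i; j] &
  `| `|x i - (m i)%:~R| - `|x j - (m j)%:~R| | +
    \sum_(k | k \notin [:: l; i; j]) `|x k - (m k)%:~R| <= `|x l - (m l)%:~R|.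
Proof.
move=> ij x_hol mP nplus nminus.
have nflip : ~ foldable (flip j x) i j (flip j x i + flip j x j).
  by move=> /(foldable_minus ij).
have y_hol := far_from_odd_flip j x_hol; have yP := closest_flip j mP.
have flip_sgn : (flip j x i - (flip j m i)%:~R) * (flip j x j - (flip j m j)%:~R)
    = - ((x i - (m i)%:~R) * (x j - (m j)%:~R)).
  by rewrite /flip (negbTE ij) eqxx intrN; ring.
have [uv|uv] := lerP 0 ((x i - (m i)%:~R) * (x j - (m j)%:~R)).
  split; first exact: fold_fail_same.
  have [|l lR] := fold_fail_opp ij y_hol yP _ nflip.
    by rewrite flip_sgn oppr_le0.
  rewrite !flip_dist; under eq_bigr => k _ do rewrite flip_dist.
  by exists l.
split; last by apply: fold_fail_opp => //; apply: ltW.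
have := fold_fail_same ij y_hol yP _ nflip.
rewrite !flip_dist flip_sgn oppr_ge0 => /(_ (ltW uv)).
by under eq_bigr => k _ do rewrite flip_dist.
Qed.

(** When both merges fail, any [j'] outside [l, i, j] satisfies
    [`|b i - b j| + b j' + r <= b l <= b i + b j - b j' - r], where [r > 0] is the
    sum of the remaining [b k]; this leaves no room for the inequalities that a
    failure of the merge of [i] and [j'] would give. *)
Lemma fold_fail_next (R : realType) n (x : 'I_n -> R) m i j :
  (5 <= n)%N -> i != j -> far_from_odd x -> closest false x m ->
  (forall k, 0 < `|x k - (m k)%:~R|) ->
  ~ foldable x i j (x i + x j) -> ~ foldable x i j (x i - x j - 2) ->
  exists2 j', i != j' & foldable x i j' (x i + x j').
Proof.
move=> n5 ij x_hol mP b_gt0 nplus nminus.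
pose b k := `|x k - (m k)%:~R|.
have {}b_gt0 k : 0 < b k by exact: b_gt0.
have b_ge0 k : 0 <= b k by exact: ltW.
have [same [l lij opp]] : \sum_(k | k \notin [:: i; j]) b k <= b i + b j /\
    exists2 l, l \notin [:: i; j] &
    `|b i - b j| + \sum_(k | k \notin [:: l; i; j]) b k <= b l.
  exact: fold_fail_both ij x_hol mP nplus nminus.
have [j' j'lij] : exists j', j' \notin [:: l; i; j].
  by apply: exists_off; apply: leq_trans n5.
have [ij' jj' lj' il jl] : [/\ i != j', j != j', l != j', i != l & j != l].
  move: j'lij lij; rewrite !inE !negb_or ![_ == j']eq_sym.
  by move=> /and3P[-> -> ->] /andP[]; rewrite ![l == _]eq_sym => -> ->.
exists j' => //; apply: contrapT => nfold.
have [[bi bj] [bl bj']] := ((b_gt0 i, b_gt0 j), (b_gt0 l, b_gt0 j')).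
pose r := \sum_(k | k \notin [:: j'; l; i; j]) b k.
have r_gt0 : 0 < r by apply: sum_off_gt0.
have lijE : \sum_(k | k \notin [:: l; i; j]) b k = b j' + r.
  exact: sum_off_cons.
have ijE : \sum_(k | k \notin [:: i; j]) b k = b l + (b j' + r).
  by rewrite -lijE; apply: sum_off_cons.
have lij'E : \sum_(k | k \notin [:: l; i; j']) b k = b j + r.
  rewrite (sum_off_cons (l := j)); last first.
    by rewrite !inE !negb_or jl (eq_sym j) ij jj'.
  congr (_ + _); apply: eq_sum_off => k; rewrite !inE.
  by case: (k == l); case: (k == j); case: (k == i); case: (k == j').
have jij'E : \sum_(k | k \notin [:: j; i; j']) b k = b l + r.
  rewrite (sum_off_cons (l := l)); last first.
    by rewrite !inE !negb_or !(eq_sym l) jl il eq_sym lj'.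
  congr (_ + _); apply: eq_sum_off => k; rewrite !inE.
  by case: (k == l); case: (k == j); case: (k == i); case: (k == j').
have ij'E : \sum_(k | k \notin [:: i; j']) b k = b l + (b j + r).
  rewrite -lij'E; apply: sum_off_cons.
  by rewrite !inE !negb_or (eq_sym l) il lj'.
rewrite lijE in opp; rewrite ijE in same.
have opp1 := le_trans (lerD (ler_norm _) (lexx _)) opp.
rewrite distrC in opp; have opp2 := le_trans (lerD (ler_norm _) (lexx _)) opp.
have [uv|uv] := lerP 0 ((x i - (m i)%:~R) * (x j' - (m j')%:~R)).
  have F : \sum_(k | k \notin [:: i; j']) b k <= b i + b j'.
    exact: fold_fail_same ij' x_hol mP uv nfold.
  by rewrite ij'E in F; lra.
have [k kij' F] : exists2 k, k \notin [:: i; j'] &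
    `|b i - b j'| + \sum_(k0 | k0 \notin [:: k; i; j']) b k0 <= b k.
  exact: fold_fail_opp ij' x_hol mP (ltW uv) nfold.
have {}F := le_trans (lerD (ler_norm _) (lexx _)) F.
have [kj|kj] := eqVneq k j; first by rewrite kj jij'E in F; lra.
have [kl|kl] := eqVneq k l; first by rewrite kl lij'E in F; lra.
have [ki kj'] : k != i /\ k != j'.
  by move: kij'; rewrite !inE negb_or => /andP[].
have F1 : b j + b l <= \sum_(k0 | k0 \notin [:: k; i; j']) b k0.
  apply: sum_off_ge2 => //; rewrite !inE !negb_or ?(eq_sym _ k).
    by rewrite kj jj' (eq_sym j i) ij.
  by rewrite kl lj' !(eq_sym l) jl il.
have F2 : b j' + b k <= b j' + r.
  rewrite lerD2l; apply: sum_off_ge1 => //.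
  by rewrite !inE !negb_or kj' kl ki kj.
lra.
Qed.

(** With [p], [q] the indices of the two smallest [b] and [L] that of the largest
    remaining one: merging [p] and [q] can fail only if their signs are
    opposite, and merging [L] with [p] or with [q] can fail only if the signs are
    equal, which cannot hold for both. *)
Lemma exists_foldable (R : realType) n (x : 'I_n -> R) m :
  (5 <= n)%N -> far_from_odd x -> closest false x m ->
  (forall k, 0 < `|x k - (m k)%:~R|) ->
  exists i j, i != j /\ foldable x i j (x i + x j).
Proof.
move=> n5 x_hol mP b_gt0; pose b k := `|x k - (m k)%:~R|.
have {}b_gt0 k : 0 < b k by exact: b_gt0.
have b_ge0 k : 0 <= b k by exact: ltW.
have pick s : (size s < 5)%N -> exists k : 'I_n, k \notin s.
  by move=> s5; apply: exists_off; apply: leq_trans n5.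
have [i0 _] := pick [::] isT.
have [p _ pP] := arg_minP (P := xpredT) b (i0 := i0) isT.
have [i1 i1p] := pick [:: p] isT.
have [q qp qP] := arg_minP (P := fun k => k \notin [:: p]) b i1p.
have [i2 i2p] := pick [:: p; q] isT.
have [L Lpq LP] := arg_maxP (P := fun k => k \notin [:: p; q]) b i2p.
have pq : p != q by move: qp; rewrite inE eq_sym.
have [Lp Lq] : L != p /\ L != q by move: Lpq; rewrite !inE negb_or => /andP[].
have qP' k : k \notin [:: p; q] -> b q <= b k.
  by rewrite !inE negb_or => /andP[kp _]; apply: qP; rewrite inE.
apply: contrapT => none.
have nfold i j : i != j -> ~ foldable x i j (x i + x j).
  by move=> ij f; apply: none; exists i, j.
(* Stated for both orderings of the two smallest, to be used with either one
   merged with [L]. *)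
have opp c d : c != d -> L != c -> L != d ->
    (forall k, k \notin [:: c; d] -> b c <= b k /\ b k <= b L) -> b d <= b L ->
    0 < (x L - (m L)%:~R) * (x c - (m c)%:~R).
  move=> cd Lc Ld cP dL; rewrite ltNge; apply/negP => uv.
  have [k kLc F] : exists2 k, k \notin [:: L; c] &
      `|b L - b c| + \sum_(k0 | k0 \notin [:: k; L; c]) b k0 <= b k.
    exact: fold_fail_opp Lc x_hol mP uv (nfold _ _ Lc).
  have {}F := le_trans (lerD (ler_norm _) (lexx _)) F.
  have [kL kc] : k != L /\ k != c by move: kLc; rewrite !inE negb_or => /andP[].
  have [r r_off] := pick [:: c; d; L; k] isT.
  have [rc rd rL rk] : [/\ r != c, r != d, r != L & r != k].
    by move: r_off; rewrite !inE !negb_or => /and4P[].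
  have [cr _] : b c <= b r /\ b r <= b L.
    by apply: cP; rewrite !inE negb_or rc rd.
  have [kd|kd] := eqVneq k d.
    have [r' r'_off] := pick [:: r; c; d; L] isT.
    have F1 : b r + b r' <= \sum_(k0 | k0 \notin [:: k; L; c]) b k0.
      apply: sum_off_ge2 => //; first by rewrite !inE !negb_or rk rL rc.
      move: r'_off; rewrite !inE !negb_or kd.
      by move=> /and4P[-> -> -> ->].
    have := b_gt0 r'; rewrite kd in F F1; lra.
  have [_ kL'] : b c <= b k /\ b k <= b L.
    by apply: cP; rewrite !inE negb_or kc kd.
  have F1 : b d + b r <= \sum_(k0 | k0 \notin [:: k; L; c]) b k0.
    apply: sum_off_ge2 => //; rewrite !inE !negb_or ?rk ?rL ?rc ?rd //.
    by rewrite (eq_sym d k) (eq_sym d L) (eq_sym d c) kd Ld cd.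
  have := b_gt0 d; lra.
have same : (x p - (m p)%:~R) * (x q - (m q)%:~R) < 0.
  rewrite ltNge; apply/negP => uv.
  have F : \sum_(k | k \notin [:: p; q]) b k <= b p + b q.
    exact: fold_fail_same pq x_hol mP uv (nfold _ _ pq).
  have [r r_off] := pick [:: L; p; q] isT.
  have [rL rp rq] : [/\ r != L, r != p & r != q].
    by move: r_off; rewrite !inE !negb_or => /and3P[].
  have [r' r'_off] := pick [:: r; L; p; q] isT.
  rewrite (sum_off_cons _ Lpq) (sum_off_cons _ r_off) in F.
  have F1 : b r' <= \sum_(k | k \notin [:: r; L; p; q]) b k by apply: sum_off_ge1.
  have pL : b p <= b L by exact: pP.
  have qr : b q <= b r by apply: qP'; rewrite !inE negb_or rp rq.
  have := b_gt0 r'; lra.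
have pL : 0 < (x L - (m L)%:~R) * (x p - (m p)%:~R).
  apply: (opp p q) => // [k kpq|]; last exact: qP'.
  by split; [apply: pP|apply: LP].
have qL : 0 < (x L - (m L)%:~R) * (x q - (m q)%:~R).
  apply: (opp q p) => // [|k kqp|]; [by rewrite eq_sym| |exact: pP].
  have kpq : k \notin [:: p; q] by move: kqp; rewrite !inE orbC.
  by split; [apply: qP'|apply: LP].
have := mulr_gt0 pL qL; rewrite mulrACA; move: same.
set t := _ * (x q - _) => t_lt0; have := sqr_ge0 (x L - (m L)%:~R).
by rewrite expr2; set v := _ * _ => v_ge0; nra.
Qed.

(** * Merges that keep positivity as well *)

Definition admissible (R : realType) n (x : 'I_n -> R) : Prop :=
  (forall k, -1 < x k) /\ - 2 < \sum_k x k.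

(** The positivity conditions on the two merges are written out: the sum merge
    leaves the total unchanged, and the difference merge changes it to
    [S - 2 * x j - 2]. *)
Definition reducible (R : realType) n (x : 'I_n -> R) : Prop :=
  exists i j, i != j /\
    ((-1 < x i + x j /\ foldable x i j (x i + x j)) \/
     [/\ x j + 1 < x i, 2 * x j < \sum_k x k &
         foldable x i j (x i - x j - 2)]).

Definition nonintegral (R : realType) n (x : 'I_n -> R) : Prop :=
  forall k (z : int), x k != z%:~R.

(** An entry that is an integer cannot be part of a failing pair, by
    [witness_floor].  It is nonnegative, so no pair sum drops below [-1]. *)
Lemma reducible_integral (R : realType) n (x : 'I_n -> R) k (z : int) :
  (1 < n)%N -> far_from_odd x -> admissible x -> x k = z%:~R -> reducible x.
Proof.
move=> n1 x_hol [x_gt _] xkz; have [j jk] := exists_off (s := [:: k]) n1.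
have kj : k != j by rewrite inE eq_sym in jk.
have z0 : 0 <= z by rewrite -ltzD1 -(ltr_int R) intrD -xkz; have := x_gt k; lra.
have xk0 : 0 <= x k by rewrite xkz ler0z.
exists k, j; split=> //; left; split; first by have := x_gt j; lra.
apply: contrapT => /nfoldableP[m /(witness_floor kj x_hol)[_]].
by rewrite xkz intrKfloor ltxx.
Qed.

Lemma nonintegral_gap (R : realType) n (x : 'I_n -> R) k (z : int) :
  nonintegral x -> 0 < `|x k - z%:~R|.
Proof. by move=> x_int; rewrite normr_gt0 subr_eq0. Qed.

(** Here [x p > 0], hence every sum merge with [p] keeps positivity and
    [fold_fail_next] applies. *)
Lemma reducible_wide (R : realType) n (x : 'I_n -> R) p q :
  (5 <= n)%N -> far_from_odd x -> admissible x -> nonintegral x ->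
  x q + 1 < x p -> 2 * x q < \sum_k x k -> reducible x.
Proof.
move=> n5 x_hol [x_gt _] x_int qp qS.
have pq : p != q by apply/eqP => E; move: qp; rewrite E; lra.
have [m mP] := exists_closest false x (@leq_trans 5 1 n isT n5).
have [plus|nplus] := pselect (foldable x p q (x p + x q)).
  by exists p, q; split=> //; left; split=> //; have := x_gt q; lra.
have [minus|nminus] := pselect (foldable x p q (x p - x q - 2)).
  by exists p, q; split=> //; right.
have [k pk fk] := fold_fail_next n5 pq x_hol mP
  (fun k => nonintegral_gap k (m k) x_int) nplus nminus.
exists p, k; split=> //; left; split=> //.
by have := x_gt q; have := x_gt k; lra.
Qed.

(** The total [S] of the entries is within 1 of the odd total of the witness, and
    -1 is the only odd integer within 1 of a number strictly between -2 and 0. *)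
Lemma witness_sum_eqN1 (R : realType) n (x : 'I_n -> R) i j m :
  i != j -> witness x i j (x i + x j) m -> - 2 < \sum_k x k -> \sum_k x k < 0 ->
  m i + m j + \sum_(k | k \notin [:: i; j]) m k = -1.
Proof.
move=> ij [mo mw] S_gt S_lt.
have us : uniq [:: i; j] by rewrite /= inE ij.
have ME : \sum_k m k = m i + m j + \sum_(k | k \notin [:: i; j]) m k.
  by rewrite (sum_off _ us) !big_cons big_nil addr0.
have SE : \sum_k x k = x i + x j + \sum_(k | k \notin [:: i; j]) x k.
  by rewrite (sum_off _ us) !big_cons big_nil addr0.
have SM : `|\sum_k x k - (\sum_k m k)%:~R| <= 1.
  apply: le_trans mw; rewrite ME SE [(m i + m j + _)%:~R]intrD opprD addrACA.
  apply: le_trans (ler_normD _ _) _; rewrite lerD2l.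
  rewrite (raddf_sum (intmul 1)) -sumrB; exact: ler_norm_sum.
rewrite -ME; move: SM mo; set M := \sum_k m k; set S := \sum_k x k in S_gt S_lt *.
rewrite ler_norml => /andP[SM1 SM2] mo.
have M1 : M < 1 by rewrite -(ltr_int R); lra.
have M3 : - 3 < M by rewrite -(ltr_int R) (_ : (-3)%:~R = -3 :> R) //; lra.
by move: mo M1 M3; clear; rewrite /oddz; lia.
Qed.

(** The differences between the merged tuple and the witness add up to [S + 1]
    and have absolute values adding up to at most 1, so their positive parts add
    up to at most [1 + S / 2 <= 1 + x q].  Hence no coordinate of the witness is
    below -1, and a coordinate equal to -1 uses up the whole bound.  As the total
    is -1, exactly one coordinate is -1 and the others vanish, while no other
    entry exceeds its coordinate. *)
Lemma fold_fail_low_sum (R : realType) n (x : 'I_n -> R) i j q :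
  i != j -> - 1 < x q -> x q < 0 -> (forall k, x q <= x k) ->
  -2 < \sum_k x k -> \sum_k x k <= 2 * x q -> x q < x i + x j ->
  ~ foldable x i j (x i + x j) ->
  [/\ x i + x j <= 0, 2 * x q <= \sum_k x k &
   exists2 k, k \notin [:: i; j] &
     x k = x q /\ forall r, r \notin [:: k; i; j] -> x r <= 0].
Proof.
move=> ij q_gt q_lt q_min S_gt S_le ij_gt /nfoldableP[m mw].
have us : uniq [:: i; j] by rewrite /= inE ij.
have M1 := witness_sum_eqN1 ij mw S_gt (le_lt_trans S_le _).
have {}M1 : m i + m j + \sum_(k | k \notin [:: i; j]) m k = -1.
  by apply: M1; lra.
have {mw}[_ mw] := mw.
(* Twice the positive part of [v]. *)
pose pos (v : R) : R := `|v| + v.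
have pos_ge0 v : 0 <= pos v by rewrite /pos; case: (ger0P v) => ?; lra.
have pos_ge2 v : 2 * v <= pos v by rewrite /pos; case: (ger0P v) => ?; lra.
have SE : \sum_k x k = x i + x j + \sum_(k | k \notin [:: i; j]) x k.
  by rewrite (sum_off _ us) !big_cons big_nil addr0.
have posS : pos (x i + x j - (m i + m j)%:~R) +
    \sum_(k | k \notin [:: i; j]) pos (x k - (m k)%:~R) <= 2 + \sum_k x k.
  rewrite /pos big_split /= sumrB -(raddf_sum (intmul 1)) SE.
  have := congr1 (intmul (1 : R)) M1.
  rewrite intrD (_ : (-1)%:~R = -1 :> R) //; move: mw.
  set A := `|_|; set B := \sum_(k | _) `|_|; set C := \sum_(k | _) x k.
  by set D := _%:~R; set E := _%:~R; lra.
have pos_off_ge0 k : k \notin [:: i; j] -> 0 <= pos (x k - (m k)%:~R) by [].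
have m0 : 0 <= m i + m j.
  rewrite -ltzD1 -(ltr_int R) intrD.
  have := sum_off_ge0 pos_off_ge0; have := pos_ge2 (x i + x j - (m i + m j)%:~R).
  by lra.
have mk_ge k : k \notin [:: i; j] -> x k - (m k)%:~R <= 1 + x q.
  move=> kij; have := sum_off_ge1 pos_off_ge0 kij.
  have := pos_ge0 (x i + x j - (m i + m j)%:~R).
  by have := pos_ge2 (x k - (m k)%:~R); lra.
have [k /andP[kij mk_lt]|no_neg] :=
  pickP (fun k => (k \notin [:: i; j]) && (m k < 0)); last first.
  have : 0 <= \sum_(k | k \notin [:: i; j]) m k.
    apply: sumr_ge0 => k kij; rewrite leNgt; apply/negP => mk.
    by have := no_neg k; rewrite kij mk.
  by move: M1 m0; clear; lia.
have mkE : m k = -1.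
  have : -2 < m k.
    rewrite -(ltr_int R) (_ : (-2)%:~R = -2 :> R) //.
    by have := mk_ge k kij; have := q_min k; lra.
  by move: mk_lt; clear; lia.
have xkE : x k = x q.
  apply/eqP; rewrite eq_le q_min andbT.
  by have := mk_ge k kij; rewrite mkE (_ : (-1)%:~R = -1 :> R) //; lra.
have posk : pos (x k - (m k)%:~R) = 2 * (1 + x q).
  by rewrite /pos mkE (_ : (-1)%:~R = -1 :> R) // xkE ger0_norm; lra.
have kpos_ge0 r : r \notin [:: k; i; j] -> 0 <= pos (x r - (m r)%:~R) by [].
rewrite (sum_off_cons _ kij) posk in posS.
have pos0_ge := pos_ge0 (x i + x j - (m i + m j)%:~R).
have posr_ge := sum_off_ge0 kpos_ge0.
have x0_le : x i + x j <= (m i + m j)%:~R.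
  by have := pos_ge2 (x i + x j - (m i + m j)%:~R); lra.
have xr_le r : r \notin [:: k; i; j] -> x r <= (m r)%:~R.
  move=> rkij; have := sum_off_ge1 kpos_ge0 rkij.
  by have := pos_ge2 (x r - (m r)%:~R); lra.
have mr_ge0 r : r \notin [:: k; i; j] -> 0 <= m r.
  move=> rkij; rewrite -ltzD1 -(ltr_int R) intrD.
  by have := xr_le r rkij; have := q_min r; lra.
rewrite (sum_off_cons _ kij) mkE in M1.
have mr_sum := sum_off_ge0 mr_ge0.
have m00 : m i + m j = 0.
  by move: M1 m0 mr_sum; move: (m i + m j) (\sum_(_ | _) _) => a c; clear; lia.
have mrE r : r \notin [:: k; i; j] -> m r = 0.
  move=> rkij; have := sum_off_ge1 mr_ge0 rkij; have := mr_ge0 r rkij.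
  by move: M1; rewrite m00; move: (\sum_(_ | _) _) => c; clear; lia.
split; first by move: x0_le; rewrite m00.
  by lra.
exists k => //; split=> // r rkij.
by have := xr_le r rkij; rewrite mrE.
Qed.

(** If the merge of [p] and [q] fails, [fold_fail_low_sum] shows [S = 2 * x q]
    and leaves no positive entry but [x p].  For a third index [j] the sum
    [x p + x j] then balances the remaining negative entries, so it is positive,
    which [fold_fail_low_sum] forbids for a failing pair. *)
Lemma reducible_low_sum (R : realType) n (x : 'I_n -> R) p q :
  (5 <= n)%N -> far_from_odd x -> admissible x -> nonintegral x ->
  (forall k, x q <= x k) -> x q < 0 -> 0 < x p ->
  \sum_k x k <= 2 * x q -> reducible x.
Proof.
move=> n5 x_hol [x_gt S_gt] x_int q_min q_lt p_gt S_le.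
have pq : p != q by apply/eqP => E; move: p_gt; rewrite E; lra.
have ok j : p != j -> foldable x p j (x p + x j) -> reducible x.
  move=> pj fj; exists p, j; split=> //; left; split=> //.
  by have := x_gt j; lra.
have [/(ok _ pq) //|nf] := pselect (foldable x p q (x p + x q)).
have drop j (pj : p != j) :=
  @fold_fail_low_sum _ _ x p j q pj (x_gt q) q_lt q_min S_gt S_le.
have [pq_le S_ge [k kpq [xkE x_le]]] : [/\ x p + x q <= 0,
    2 * x q <= \sum_k x k &
   exists2 k, k \notin [:: p; q] &
     x k = x q /\ forall r, r \notin [:: k; p; q] -> x r <= 0].
  by apply: drop => //; lra.
have [j jkpq] : exists j, j \notin [:: k; p; q].
  by apply: exists_off; apply: leq_trans n5.
have pj : p != j.
  by move: jkpq; rewrite !inE !negb_or eq_sym => /and3P[_ + _]; rewrite eq_sym.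
apply: (ok j pj); apply: contrapT => nfj.
have rest : 0 < \sum_(r | r \notin [:: j; k; p; q]) - x r.
  apply: sum_off_gt0 => // r; rewrite inE negb_or => /andP[_ rkpq].
  by rewrite oppr_gt0 lt_neqAle x_le // andbT; apply: (x_int r 0).
rewrite sumrN in rest.
have us : uniq [:: p; q] by rewrite /= inE pq.
have SE : \sum_k x k = x p + (x q + 0) +
    (x k + (x j + \sum_(r | r \notin [:: j; k; p; q]) x r)).
  by rewrite (sum_off _ us) !big_cons big_nil (sum_off_cons _ kpq) (sum_off_cons _ jkpq).
have pj_gt : 0 < x p + x j by lra.
by have [] := drop j pj _ nfj; lra.
Qed.

(** The two largest entries have sum more than [S / 2], because the other
    entries, at least three and negative, come in below them.  All integer parts
    are -1, so a witness has sum -1 on the pair and 0 elsewhere; its distance is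
    then at least [1 + 2 * (x i + x j) - S > 1]. *)
Lemma reducible_negative (R : realType) n (x : 'I_n -> R) :
  (5 <= n)%N -> far_from_odd x -> admissible x -> (forall k, x k < 0) -> reducible x.
Proof.
move=> n5 x_hol [x_gt S_gt] x_lt.
have pick s : (size s < 5)%N -> exists k : 'I_n, k \notin s.
  by move=> s5; apply: exists_off; apply: leq_trans n5.
have [i0 _] := pick [::] isT.
have [i _ iP] := arg_maxP (P := xpredT) x (i0 := i0) isT.
have [i1 i1i] := pick [:: i] isT.
have [j ji jP] := arg_maxP (P := fun k => k \notin [:: i]) x i1i.
have ij : i != j by move: ji; rewrite inE eq_sym.
have us : uniq [:: i; j] by rewrite /= inE ij.
have [r rij] := pick [:: i; j] isT.
have [s srij] := pick [:: r; i; j] isT.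
have [t tsrij] := pick [:: s; r; i; j] isT.
have Nx_ge0 k : 0 <= - x k by rewrite oppr_ge0 ltW.
have SE : \sum_k x k = x i + (x j + 0) + (x r + (x s +
    \sum_(k | k \notin [:: s; r; i; j]) x k)).
  by rewrite (sum_off _ us) !big_cons big_nil (sum_off_cons _ rij) (sum_off_cons _ srij).
have tail : 0 < - \sum_(k | k \notin [:: s; r; i; j]) x k.
  by rewrite -sumrN; apply: sum_off_gt0 => // k _; rewrite oppr_gt0.
have xr : x r <= x i by exact: iP.
have xs : x s <= x j by apply: jP; move: srij; rewrite !inE !negb_or => /and3P[_ ->].
have S_lt : \sum_k x k < 2 * (x i + x j) by lra.
exists i, j; split=> //; left; split; first by lra.
apply: contrapT => /nfoldableP[m mw].
have M1 := witness_sum_eqN1 ij mw S_gt.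
have {}M1 : m i + m j + \sum_(k | k \notin [:: i; j]) m k = -1.
  by apply: M1; have := x_lt i; have := x_lt j; lra.
have fl k : Num.floor (x k) = -1 by apply: floor_neg => //; apply: ltW.
have [] := witness_floor ij x_hol mw; rewrite !fl => m0 _ _.
have mij : m i + m j = -1 by rewrite m0.
have off0 : \sum_(k | k \notin [:: i; j]) m k = 0.
  by move: M1; rewrite mij; clear; lia.
have {mw}[_] := mw; rewrite mij (_ : (-1)%:~R = -1 :> R) //.
have off_ge : x i + x j - \sum_k x k <=
    \sum_(k | k \notin [:: i; j]) `|x k - (m k)%:~R|.
  apply: le_trans (ler_norm_sum _ _ _); rewrite sumrB -(raddf_sum (intmul 1)).
  rewrite off0 subr0 SE -normrN.
  apply: le_trans (ler_norm _).
  by rewrite (sum_off_cons _ rij) (sum_off_cons _ srij); lra.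
by rewrite ger0_norm; lra.
Qed.

(** * Entries in a window of length one *)

(** Off the merged pair a witness may be clamped to the integers that bracket
    the entries. *)
Lemma witness_clamp (R : realType) n (x : 'I_n -> R) i j a m :
  witness x i j a m -> exists2 m', witness x i j a m' &
  forall k, k \notin [:: i; j] ->
    m' k = Num.floor (x k) \/ m' k = Num.floor (x k) + 1.
Proof.
move=> [mo mw].
pose m' k := if k \in [:: i; j] then m k else clamp (x k) (m k).
have m'i : m' i = m i by rewrite /m' !inE eqxx.
have m'j : m' j = m j by rewrite /m' !inE eqxx orbT.
exists m' => [|k /negbTE kij]; last first.
  by rewrite /m' kij /clamp; case: oddz; [right|left; rewrite addr0].
split.
  have -> // : oddz (\sum_k m' k) = oddz (\sum_k m k).
  apply: oddz_sum_congr => k _.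
  by rewrite /m'; case: ifP => // _; rewrite oddz_clamp.
rewrite m'i m'j; apply: le_trans mw; rewrite lerD2l.
by apply: ler_sum => k /negbTE kij; rewrite /m' kij clamp_le.
Qed.

(** What is left of the narrow case once easier merges are set aside: the pair
    [a, c] cannot be merged because of positivity, and [p] is positive. *)
Definition window (R : realType) n (x : 'I_n -> R) (a c p : 'I_n) : Prop :=
  [/\ forall k, x a <= x k <= x p, x p <= x a + 1, x a + x c <= -1,
      0 < x p & uniq [:: c; p; a]].

Lemma window_digit (R : realType) n (x : 'I_n -> R) a c p k (z : int) :
  admissible x -> nonintegral x -> window x a c p ->
  z = Num.floor (x k) \/ z = Num.floor (x k) + 1 ->
  if x k < 0 then z = 0 \/ z = -1 else z = 0 \/ z = 1.
Proof.
move=> [x_gt _] x_int [x_in pa ac p_gt us] zE; case: ifPn => xk.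
  have fk : Num.floor (x k) = -1 by apply: floor_neg => //; apply: ltW.
  by case: zE => ->; rewrite fk; [right|left].
have fk : Num.floor (x k) = 0.
  apply: floor_pos; first by rewrite leNgt.
  have /andP[_ xkp] := x_in k; have /andP[xac _] := x_in c.
  by move: xkp xac pa ac (x_gt a); clear; lra.
by case: zE => ->; rewrite fk; [left|right].
Qed.

(** A nonzero coordinate of a witness costs at least [1 + x a], and so does
    the coordinate of [c] in any case.  The budget [1 + x p + x a] is at most
    [2 * (1 + x a)], so with something left over for the other entries only one
    coordinate can be nonzero, and parity makes it that of [c]. *)
Lemma window_fail (R : realType) n (x : 'I_n -> R) a c p :
  (5 <= n)%N -> far_from_odd x -> admissible x -> nonintegral x -> window x a c p ->
  ~ foldable x p a (x p + x a) ->
  \sum_(k | k \notin [:: c; p; a]) `|x k| <= x p + x a - x c.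
Proof.
move=> n5 x_hol x_adm x_int win /nfoldableP[m0 /witness_clamp[m mw mcl]].
have digit k kpa := window_digit x_adm x_int win (mcl k kpa).
have [x_gt _] := x_adm; have [x_in pa ac p_gt us] := win.
have xa_le k : x a <= x k by have /andP[] := x_in k.
have xp_ge k : x k <= x p by have /andP[] := x_in k.
have xac := xa_le c.
have [cpa pa_neq] : c \notin [:: p; a] /\ p != a.
  by move: us; rewrite cons_uniq => /andP[-> /=]; rewrite inE andbT.
have us' : uniq [:: p; a] by rewrite /= inE pa_neq.
have mpa : m p + m a = 0.
  have [-> _ _] := witness_floor pa_neq x_hol mw.
  rewrite floor_pos ?floor_neg ?ltW ?x_gt //; lra.
have [mo mle] := mw.
have {}mle : \sum_(k | k \notin [:: p; a]) `|x k - (m k)%:~R| <= 1 + x p + x a.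
  by move: mle; rewrite mpa subr0 ler0_norm; lra.
have A_gt0 k : 0 < `|x k - (m k)%:~R| by apply: nonintegral_gap.
have A_ge0 k : 0 <= `|x k - (m k)%:~R| by [].
have cost k : k \notin [:: p; a] -> m k != 0 -> 1 + x a <= `|x k - (m k)%:~R|.
  move=> kpa mk0; have := digit k kpa; have := xa_le k; have := xp_ge k.
  case: ifPn => xk xkp xka [mk|mk]; rewrite mk ?eqxx // in mk0 *.
    by rewrite (_ : (-1)%:~R = -1 :> R) // ger0_norm; lra.
  by rewrite ler0_norm; lra.
rewrite (sum_off_cons _ cpa) in mle.
have two k : k \notin [:: c; p; a] ->
    2 * (1 + x a) <= `|x c - (m c)%:~R| + `|x k - (m k)%:~R| -> False.
  move=> kcpa; rewrite (sum_off_cons _ kcpa) in mle.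
  have : 0 < \sum_(r | r \notin [:: k; c; p; a]) `|x r - (m r)%:~R|.
    by apply: sum_off_gt0.
  by move: mle; lra.
have xc_lt : x c < 0 by have := x_gt a; lra.
have mcE : m c = -1.
  have := digit c cpa; rewrite xc_lt => -[mc0|//]; exfalso.
  have R_odd : oddz (\sum_(k | k \notin [:: p; a]) m k).
    move: mo; rewrite (sum_off _ us') !big_cons big_nil addr0 mpa add0r.
    exact.
  have [k kpa ko] := exists_odd_term R_odd.
  have kc : k != c by apply/eqP => kc; move: ko; rewrite kc mc0.
  apply: (two k); first by rewrite in_cons negb_or kc.
  have mk0 : m k != 0 by apply/eqP => mk0; move: ko; rewrite mk0.
  by have := cost k kpa mk0; rewrite mc0 subr0 [`|x c|]ltr0_norm; lra.
have Ac : `|x c - (m c)%:~R| = 1 + x c.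
  by rewrite mcE (_ : (-1)%:~R = -1 :> R) // ger0_norm; have := x_gt c; lra.
have mk0 k : k \notin [:: c; p; a] -> m k = 0.
  move=> kcpa; apply/eqP; apply: contrapT => /negP mk.
  apply: (two k kcpa); rewrite Ac.
  have kpa : k \notin [:: p; a].
    by move: kcpa; rewrite in_cons negb_or => /andP[].
  by have := cost k kpa mk; lra.
rewrite Ac in mle.
have -> : \sum_(k | k \notin [:: c; p; a]) `|x k| =
    \sum_(k | k \notin [:: c; p; a]) `|x k - (m k)%:~R|.
  by apply: eq_bigr => k /mk0->; rewrite subr0.
by lra.
Qed.

(** The inequality obtained from the failing pair [p, a] makes all entries
    outside [a, c, p] small.  A witness against [p, j] has coordinates 0 or -1 at
    [a] and at [c]; in each of the four cases either the cost at these two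
    coordinates is too large, or parity requires a further nonzero coordinate,
    which is expensive because its entry is small. *)
Lemma window_next (R : realType) n (x : 'I_n -> R) a c p j :
  (5 <= n)%N -> far_from_odd x -> admissible x -> nonintegral x -> window x a c p ->
  \sum_(k | k \notin [:: c; p; a]) `|x k| <= x p + x a - x c ->
  j \notin [:: c; p; a] -> foldable x p j (x p + x j).
Proof.
move=> n5 x_hol x_adm x_int win small jcpa.
apply: contrapT => /nfoldableP[m0 /witness_clamp[m mw mcl]].
have digit k kpj := window_digit x_adm x_int win (mcl k kpj).
have [x_gt _] := x_adm; have [x_in pa ac p_gt us] := win.
have xa_le k : x a <= x k by have /andP[] := x_in k.
have xac := xa_le c.
have [[jc jp ja] [cp ca pa_neq]] :
    [/\ j != c, j != p & j != a] /\ [/\ c != p, c != a & p != a].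
  move: jcpa us; rewrite /= !inE !negb_or => /and3P[-> -> ->].
  by rewrite andbT => /andP[/andP[-> ->] ->].
have pj : p != j by rewrite eq_sym.
have us' : uniq [:: p; j] by rewrite /= inE pj.
have cpj : c \notin [:: p; j] by rewrite !inE negb_or cp eq_sym.
have acpj : a \notin [:: c; p; j].
  by rewrite !inE !negb_or !(eq_sym a) ca pa_neq ja.
have [mo mle] := mw.
pose A k := `|x k - (m k)%:~R|.
have A_gt0 k : 0 < A k by exact: nonintegral_gap.
have A_ge0 k : 0 <= A k by exact: ltW.
have {}mle : `|x p + x j - (m p + m j)%:~R| +
  \sum_(k | k \notin [:: p; j]) A k <= 1 by exact: mle.
rewrite (sum_off_cons _ cpj) (sum_off_cons _ acpj) in mle.
pose Q := [:: a; c; p; j].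
have Q_gt0 : 0 < \sum_(k | k \notin Q) A k by apply: sum_off_gt0.
have Xsum : \sum_(k | k \notin [:: c; p; a]) `|x k| =
    `|x j| + \sum_(k | k \notin Q) `|x k|.
  rewrite (sum_off_cons _ jcpa); congr (_ + _); apply: eq_sum_off => k.
  rewrite !inE.
  by case: (k == j); case: (k == c); case: (k == p); case: (k == a).
rewrite Xsum in small.
have X_gt0 : 0 < \sum_(k | k \notin Q) `|x k|.
  apply: sum_off_gt0 => // k _; rewrite normr_gt0; exact: (x_int k 0).
have Q_odd : oddz (\sum_(k | k \notin Q) m k) ->
    exists2 X, `|x j| + X <= x p + x a - x c & 1 - X <= \sum_(k | k \notin Q) A k.
  move=> /exists_odd_term[k kQ ko].
  exists `|x k|.
    have : `|x k| <= \sum_(r | r \notin Q) `|x r|.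
      by apply: (sum_off_ge1 (F := fun r => `|x r|)).
    by move: small; clear; lra.
  have : A k <= \sum_(r | r \notin Q) A r by apply: sum_off_ge1.
  apply: le_trans; rewrite /A lerBlDr.
  have mk1 : 1 <= `|(m k)%:~R| :> R.
    rewrite -intr_norm (ler_int _ 1).
    by move: ko; clear; rewrite /oddz; lia.
  apply: le_trans mk1 _; rewrite -(normrN (_ - _)).
  rewrite -{1}(subrK (x k) (m k)%:~R) opprB; exact: ler_normD.
have total : oddz (m p + m j + m c + m a + \sum_(k | k \notin Q) m k).
  move: mo; rewrite (sum_off _ us') !big_cons big_nil addr0.
  by rewrite (sum_off_cons _ cpj) (sum_off_cons _ acpj) !addrA.
have xc_lt : x c < 0 by move: (x_gt a) ac; clear; lra.
have xa_lt : x a < 0 by move: xac xc_lt; clear; lra.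
have cE : (m c = 0 /\ A c = - x c) \/ (m c = -1 /\ A c = 1 + x c).
  have := digit c cpj; rewrite xc_lt /A => -[->|->].
    by left; rewrite subr0 ltr0_norm.
  right; split=> //; rewrite (_ : (-1)%:~R = -1 :> R) // ger0_norm.
    by rewrite opprK addrC.
  by have := x_gt c; clear; lra.
have aE : (m a = 0 /\ A a = - x a) \/ (m a = -1 /\ A a = 1 + x a).
  have apj : a \notin [:: p; j].
    by move: acpj; rewrite in_cons negb_or => /andP[].
  have := digit a apj; rewrite xa_lt /A => -[->|->].
    by left; rewrite subr0 ltr0_norm.
  right; split=> //; rewrite (_ : (-1)%:~R = -1 :> R) // ger0_norm.
    by rewrite opprK addrC.
  by have := x_gt a; clear; lra.
have [mpj _ _] := witness_floor pj x_hol mw.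
have fp : Num.floor (x p) = 0.
  by apply: floor_pos; move: pa p_gt xa_lt; clear; lra.
have xp_le j' : x j' <= x p by have /andP[] := x_in j'.
have := xp_le j; have := x_gt a; have := x_gt c.
have [xj|xj] := ltrP (x j) 0; move=> xc_gt xa_gt xjp.
  have fj : Num.floor (x j) = -1 by apply: floor_neg => //; apply: ltW.
  rewrite fp fj add0r addNr in mpj; rewrite mpj in total mle.
  rewrite ltr0_norm // in small Q_odd.
  rewrite subr0 ger0_norm in mle; last by lra.
  case: cE total mle => -[-> ->]; case: aE => -[-> ->]; rewrite ?addr0 ?add0r.
  - by move=> _; lra.
  - by move=> _; lra.
  - by move=> _; lra.
  - by rewrite oddzD => /Q_odd[X] ? ?; lra.
have fj : Num.floor (x j) = 0.
  by apply: floor_pos; move: xj xjp pa xa_lt; clear; lra.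
rewrite fp fj !add0r in mpj; rewrite mpj in total mle.
rewrite (ger0_norm xj) in small Q_odd.
rewrite ler0_norm in mle; last by lra.
case: cE total mle => -[-> ->]; case: aE => -[-> ->]; rewrite ?addr0 ?add0r.
- by move=> _; lra.
- by move=> /Q_odd[X] ? ?; lra.
- by move=> /Q_odd[X] ? ?; lra.
- by move=> _; lra.
Qed.

(** The smallest entry belongs to a pair with sum at most -1 as soon as some
    pair has such a sum. *)
Lemma reducible_narrow (R : realType) n (x : 'I_n -> R) a :
  (5 <= n)%N -> far_from_odd x -> admissible x -> nonintegral x ->
  (forall k, x a <= x k) -> (forall k, x k <= x a + 1) -> reducible x.
Proof.
move=> n5 x_hol x_adm x_int xa_le xa_ge; have [x_gt _] := x_adm.
have [[c [ca ac]]|no_bad] := pselect (exists c, c != a /\ x a + x c <= -1);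
  last first.
  have [m mP] := exists_closest false x (@leq_trans 5 1 n isT n5).
  have [i [j [ij fij]]] := exists_foldable n5 x_hol mP
    (fun k => nonintegral_gap k (m k) x_int).
  exists i, j; split=> //; left; split=> //; rewrite ltNge; apply/negP => xij.
  have [ja|ja] := eqVneq j a.
    by apply: no_bad; exists i; split; [rewrite -ja|rewrite -ja addrC].
  apply: no_bad; exists j; split=> //; apply: le_trans xij.
  by rewrite lerD2r.
have [p _ pP] := arg_maxP (P := xpredT) x (i0 := a) isT.
have xp_ge k : x k <= x p by exact: pP.
have [p_gt|p_le] := ltrP 0 (x p); last first.
  apply: reducible_negative => // k; rewrite lt_neqAle (x_int k 0) /=.
  exact: le_trans (xp_ge k) p_le.
have xac := xa_le c.
have pa : p != a by apply/eqP => E; move: p_gt; rewrite E; lra.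
have cp : c != p.
  by apply/eqP => E; move: p_gt (x_gt a); rewrite -E; lra.
have win : window x a c p.
  split=> //; first by move=> k; rewrite xa_le xp_ge.
  by rewrite /= !inE negb_or cp ca pa.
have ok j : p != j -> foldable x p j (x p + x j) -> reducible x.
  move=> pj fj; exists p, j; split=> //; left; split=> //.
  by have := x_gt j; lra.
have [/(ok _ pa) //|nf] := pselect (foldable x p a (x p + x a)).
have [j jcpa] : exists j, j \notin [:: c; p; a].
  by apply: exists_off; apply: leq_trans n5.
have pj : p != j.
  by move: jcpa; rewrite !inE !negb_or eq_sym => /and3P[_ + _]; rewrite eq_sym.
apply: (ok j pj); apply: (window_next n5 x_hol x_adm x_int win _ jcpa).
exact: window_fail win nf.
Qed.

Theorem far_from_odd_reducible (R : realType) n (x : 'I_n -> R) :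
  (5 <= n)%N -> far_from_odd x -> admissible x -> reducible x.
Proof.
move=> n5 x_hol x_adm; have [x_gt _] := x_adm.
have [[k [z xkz]]|nz] := pselect (exists k (z : int), x k = z%:~R).
  by apply: reducible_integral xkz => //; apply: leq_trans n5.
have x_int : nonintegral x.
  by move=> k z; apply/eqP => xkz; apply: nz; exists k, z.
have [i0 _] : exists k : 'I_n, k \notin [::].
  by apply: exists_off; apply: leq_trans n5.
have [q _ qP] := arg_minP (P := xpredT) x (i0 := i0) isT.
have q_min k : x q <= x k by exact: qP.
have [[p p_gt]|narrow] := pselect (exists p, x q + 1 < x p); last first.
  apply: (reducible_narrow (a := q)) => // k; rewrite leNgt; apply/negP => xk.
  by apply: narrow; exists k.
have [S_gt|S_le] := ltrP (2 * x q) (\sum_k x k).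
  exact: reducible_wide p_gt S_gt.
have q_lt : x q < 0.
  rewrite ltNge; apply/negP => q_ge.
  have x_ge0 k : k \notin [::] -> 0 <= x k by move=> _; apply: le_trans (q_min k).
  have pq : q \notin [:: p] by rewrite inE; apply/eqP => E; move: p_gt; rewrite E; lra.
  have := sum_off_ge2 x_ge0 (isT : p \notin [::]) pq.
  have -> : \sum_(k | k \notin [::]) x k = \sum_k x k by apply: eq_bigl.
  by have := q_min p; lra.
apply: (reducible_low_sum (p := p) (q := q)) => //.
by have := x_gt q; lra.
Qed.

(** * Translation to tuples of angles *)

Lemma oddz_l1norm n (m : 'rV[int]_n) :
  odd `|l1norm m|%N = oddz (\sum_k m 0 k).
Proof.
rewrite -/(oddz _) /l1norm; apply: oddz_sum_congr => k _.
by case: (ger0P (m 0 k)) => // _; rewrite oddzN.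
Qed.

(** The infimum is attained by [exists_closest], so the strict inequality on the
    distance is equivalent to a strict inequality at every odd point. *)
Lemma strict_holonomyP (R : realType) n (theta : 'rV[R]_n) : (0 < n)%N ->
  strict_holonomy theta <-> far_from_odd (fun k => theta 0 k - 1).
Proof.
move=> n0; rewrite /strict_holonomy /d1.
set D := [set _ | _ in _]%classic.
have distE (m : 'rV[int]_n) : l1norm (theta - const_mx 1 - map_mx intr m) =
    \sum_k `|theta 0 k - 1 - (m 0 k)%:~R|.
  by apply: eq_bigr => k _; rewrite !mxE.
have D_in (m : 'I_n -> int) : oddz (\sum_k m k) ->
    D (\sum_k `|theta 0 k - 1 - (m k)%:~R|).
  move=> mo; exists (map_mx intr (\row_k m k)).
    exists (\row_k m k) => //=; rewrite oddz_l1norm.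
    by rewrite (eq_bigr m) // => k _; rewrite mxE.
  by rewrite distE; apply: eq_bigr => k _; rewrite mxE.
have D_out y : D y -> exists2 m : 'I_n -> int, oddz (\sum_k m k) &
    y = \sum_k `|theta 0 k - 1 - (m k)%:~R|.
  move=> [_ [m mo <-] <-]; exists (m 0); last exact: distE.
  by rewrite -oddz_l1norm.
have D_lb : has_lbound D.
  by exists 0 => y /D_out[m _ ->]; apply: sumr_ge0.
split=> [infD m mo|x_hol].
  by apply: lt_le_trans infD _; apply: ge_inf => //; apply: D_in.
have [m [mo m_min]] := exists_closest true (fun k => theta 0 k - 1) n0.
apply: lt_le_trans (x_hol m mo) _; apply: lb_le_inf.
  by exists (\sum_k `|theta 0 k - 1 - (m k)%:~R|); apply: D_in.
by move=> y /D_out[m' m'o ->]; apply: m_min.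
Qed.

Lemma positivityP (R : realType) n (theta : 'rV[R]_n) :
  positivity theta <-> admissible (fun k => theta 0 k - 1).
Proof.
by split=> -[gt S_gt]; split=> // k; have := gt k; lra.
Qed.

(** The map [s] renumbers the indices of the merged tuple by those of the
    original one, with [i] standing for the new entry; [j] is dropped. *)
Lemma merge_pairE (R : realType) n (theta : 'rV[R]_n) (i j : 'I_n) (a : R) :
  i != j -> exists s : 'I_n -> 'I_n.-1,
  [/\ merge_pair theta i j a 0 (s i) = a,
      forall k, k \notin [:: i; j] -> merge_pair theta i j a 0 (s k) = theta 0 k,
      forall l, l = s i \/ exists2 k, k \notin [:: i; j] & l = s k &
      forall (V : zmodType) (F : 'I_n.-1 -> V),
        \sum_l F l = F (s i) + \sum_(k | k \notin [:: i; j]) F (s k)].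
Proof.
move=> ij; pose e := [seq k <- enum 'I_n | (k != i) && (k != j)].
have e_uniq : uniq e by rewrite filter_uniq ?enum_uniq.
have eE k : (k \in e) = (k \notin [:: i; j]).
  by rewrite mem_filter mem_enum andbT !inE negb_or.
have e_size : size e = n.-2.
  have us : uniq [:: i; j] by rewrite /= inE ij.
  have := cardC (mem [:: i; j]); rewrite (card_uniqP us) card_ord /=.
  rewrite (_ : #|_| = size e).
    by move: (size e) => z; clear; lia.
  by rewrite -(card_uniqP e_uniq); apply: eq_card => k; rewrite eE !inE.
have n2 : (1 < n)%N.
  case: n i j ij {e e_uniq eE e_size theta} => [[]//|[|//]] i j.
  by rewrite (ord1 i) (ord1 j) eqxx.
have n1E : n.-1 = n.-2.+1 by case: n n2 {e e_uniq eE e_size theta i j ij} => [|[]].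
pose idx k := if k == i then n.-2 else index k e.
have idx_lt k : k != j -> (idx k < n.-1)%N.
  move=> kj; rewrite /idx n1E; case: eqP => // /eqP ki.
  by rewrite ltnS -e_size ltnW // index_mem eE !inE negb_or ki kj.
have n1_gt0 : (0 < n.-1)%N by rewrite n1E.
pose s k : 'I_n.-1 := insubd (Ordinal n1_gt0) (idx k).
have sE k : k != j -> s k = idx k :> nat.
  by move=> kj; rewrite val_insubd idx_lt.
have sj k : k \notin [:: i; j] -> s k = index k e :> nat.
  rewrite !inE negb_or => /andP[ki kj].
  by rewrite sE // /idx (negbTE ki).
pose t (l : 'I_n.-1) := nth i e l.
have tE (l : 'I_n.-1) : t l != j /\ s (t l) = l.
  have [le|le] := ltnP l n.-2.
    have tl : t l \in e by rewrite mem_nth // e_size.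
    have tij : t l \notin [:: i; j] by rewrite -eE.
    split; first by move: tij; rewrite !inE negb_or => /andP[].
    by apply: val_inj; rewrite /= sj // index_uniq // e_size.
  have tl : t l = i by rewrite /t nth_default // e_size.
  rewrite tl; split=> //; apply: val_inj => /=; rewrite sE // /idx eqxx.
  by apply/eqP; rewrite eqn_leq le -ltnS -n1E ltn_ord.
exists s; split.
- rewrite mxE sE // /idx eqxx nth_rcons size_map e_size ltnn eqxx //.
- move=> k kij; rewrite mxE sj // nth_rcons size_map index_mem eE kij.
  by rewrite (nth_map i) ?nth_index ?index_mem ?eE.
- move=> l; have [tj <-] := tE l; have [->|ti] := eqVneq (t l) i; first by left.
  by right; exists (t l) => //; rewrite !inE negb_or ti tj.
move=> V F; rewrite (reindex_onto s t) => [|l _]; last by have [] := tE l.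
rewrite (eq_bigl (fun k => k != j)) => [|k]; last first.
  apply/eqP/idP => [<-|kj]; first by have [] := tE (s k).
  have [->|ki] := eqVneq k i.
    by rewrite /t nth_default // e_size sE // /idx eqxx.
  by rewrite /t sj ?nth_index ?eE ?inE ?negb_or ?ki ?kj.
rewrite (bigD1 i) //=; congr (_ + _); apply: eq_bigl => k.
by rewrite !inE negb_or andbC.
Qed.

Lemma merge_pair_far_from_odd (R : realType) n (theta : 'rV[R]_n) (i j : 'I_n) (a : R) :
  i != j -> foldable (fun k => theta 0 k - 1) i j (a - 1) ->
  far_from_odd (fun l => merge_pair theta i j a 0 l - 1).
Proof.
move=> ij fold m mo; have [s [si sk _ sumE]] := merge_pairE theta a ij.
pose m' k := if k == i then m (s i) else if k == j then 0 else m (s k).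
have m'k k : k \notin [:: i; j] -> m' k = m (s k).
  by rewrite !inE negb_or /m' => /andP[/negbTE-> /negbTE->].
have m'i : m' i = m (s i) by rewrite /m' eqxx.
have m'j : m' j = 0 by rewrite /m' eqxx eq_sym (negbTE ij).
have us : uniq [:: i; j] by rewrite /= inE ij.
have m'o : oddz (\sum_k m' k).
  move: mo; rewrite sumE (sum_off _ us) !big_cons big_nil m'i m'j !addr0.
  by rewrite (eq_bigr m') // => k /m'k->.
have := fold m' m'o; rewrite m'i m'j addr0 sumE si.
rewrite [X in _ < _ + X -> _](eq_bigr
  (fun k => `|merge_pair theta i j a 0 (s k) - 1 - (m (s k))%:~R|)) //.
by move=> k kij; rewrite m'k // sk.
Qed.

Lemma merge_pair_admissible (R : realType) n (theta : 'rV[R]_n) (i j : 'I_n)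
    (a : R) :
  i != j -> admissible (fun k => theta 0 k - 1) -> 0 < a ->
  theta 0 i + theta 0 j - a - 1 < \sum_k (theta 0 k - 1) + 2 ->
  admissible (fun l => merge_pair theta i j a 0 l - 1).
Proof.
move=> ij [gt S_gt] a_gt aS; have [s [si sk s_surj sumE]] := merge_pairE theta a ij.
have us : uniq [:: i; j] by rewrite /= inE ij.
split=> [l|].
  have [->|[k kij ->]] := s_surj l; first by rewrite si; lra.
  by rewrite sk.
rewrite sumE si (eq_bigr (fun k => theta 0 k - 1)) => [|k kij]; last by rewrite sk.
by move: aS; rewrite (sum_off _ us) !big_cons big_nil addr0; lra.
Qed.

Theorem theorem4 (R : realType) (n : nat) (hn : (5 <= n)%N)
    (theta : 'rV[R]_n)
    (hpos : positivity theta) (hhol : strict_holonomy theta) :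
  exists i j : 'I_n, i != j /\
    ((positivity (merge_pair theta i j (theta 0 i + theta 0 j - 1)) /\
      strict_holonomy (merge_pair theta i j (theta 0 i + theta 0 j - 1))) \/
     (positivity (merge_pair theta i j (theta 0 i - theta 0 j - 1)) /\
      strict_holonomy (merge_pair theta i j (theta 0 i - theta 0 j - 1)))).
Proof.
have n0 : (0 < n)%N by exact: leq_trans hn.
have n1 : (0 < n.-1)%N by case: n hn {theta hpos hhol n0} => [|[]].
have x_adm := (positivityP theta).1 hpos.
have x_hol := (strict_holonomyP theta n0).1 hhol.
have merged i j a : i != j -> 0 < a ->
    theta 0 i + theta 0 j - a - 1 < \sum_k (theta 0 k - 1) + 2 ->
    foldable (fun k => theta 0 k - 1) i j (a - 1) ->
    positivity (merge_pair theta i j a) /\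
    strict_holonomy (merge_pair theta i j a).
  move=> ij a_gt aS fold; split.
    by apply/positivityP; apply: merge_pair_admissible.
  by apply/(strict_holonomyP _ n1); apply: merge_pair_far_from_odd.
have [_ S_gt] := x_adm.
have [i [j [ij [[gt fold]|[gt S_gt' fold]]]]] := far_from_odd_reducible hn x_hol x_adm.
  exists i, j; split=> //; left; apply: merged => //; [lra|lra|].
  by rewrite (_ : _ - 1 - 1 = theta 0 i - 1 + (theta 0 j - 1)); [|ring].
exists i, j; split=> //; right; apply: merged => //; [lra|lra|].
by rewrite (_ : _ - 1 - 1 = theta 0 i - 1 - (theta 0 j - 1) - 2); [|ring].
Qed.
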